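(* Let $S$ be an infinite set and let $A\in(\mathbb{R}\cup\{-\infty\})^{S\times S}$ be such that $\rho(A)\in\mathbb{R}$. Assume that $\tilde A$ has Property (T). Then $N^c(A)=N^r(A)$ and the critical classes of $A$ coincide with the recurrence classes of $A$. Furthermore, the critical graph $G^c(A)$ coincides with the graph $G^r(A)$ having set of nodes $N^r(A)$ and an arc $(i,j)$ whenever $\tilde A_{ij}+\tilde A^+_{ji}=0$.
   Context: Write $\overline{\mathbb{R}}=\mathbb{R}\cup\{-\infty,+\infty\}$, with the convention $(-\infty)+(+\infty)=-\infty$; the supremum of the empty set is $-\infty$. For $B,C\in\overline{\mathbb{R}}^{S\times S}$ the (max-plus) product is $(BC)_{ij}=\sup_{k\in S}(B_{ik}+C_{kj})$; $B^0=I$ is the matrix with $0$ on the diagonal and $-\infty$ elsewhere, $B^n$ is the $n$-th power, $B^n_{ij}:=(B^n)_{ij}$, $B^+_{ij}:=\sup_{n\ge1}B^n_{ij}$, $B^*_{ij}:=\sup_{n\ge0}B^n_{ij}$. $G(A)$ is the digraph with node set $S$ and an arc $i\to j$ whenever $A_{ij}\ne-\infty$. A path $p=(i_0,\dots,i_n)$ in $G(A)$ has length $|p|=n$ and weight $|p|_A=\sum_{t=0}^{n-1}A_{i_ti_{t+1}}$; a circuit is a path of length $\ge1$ with $i_0=i_n$. The maximal circuit mean is $\rho(A):=\sup_{k\ge1}\sup_{i\in S}\frac1k A^k_{ii}=\sup_{c}|c|_A/|c|$, the last supremum being over all circuits $c$ of $G(A)$. When $\rho(A)\in\mathbb{R}$,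 $\tilde A$ is the matrix $\tilde A_{ij}:=A_{ij}-\rho(A)$. A node $i\in S$ is recurrent if $\tilde A^+_{ii}=0$; $N^r(A)$ is the set of recurrent nodes. Recurrence classes are the equivalence classes of $N^r(A)$ for the relation $i\,\mathcal{R}\,j\iff\tilde A^+_{ij}+\tilde A^+_{ji}=0$. The critical graph $G^c(A)$ is the subgraph of $G(A)$ which is the union (nodes and arcs) of all circuits $c$ of $G(A)$ with $|c|_A/|c|=\rho(A)$. Its nodes are the critical nodes, forming the set $N^c(A)$; the set of nodes of a strongly connected component of $G^c(A)$ is called a critical class. A map $v:S\to\overline{\mathbb{R}}$ is tight if $v_j\neq+\infty$ for all $j$ and $\{j\in S: v_j\ge\beta\}$ is finite for every $\beta\in\mathbb{R}$. For a matrix $B$, a vector $u\in\overline{\mathbb{R}}^S$ is $B$-tight if for each $i\in S$ the map $j\mapsto B_{ij}+u_j$ is tight. A matrix $B$ has Property (T) if all columns of $B^*$ are $B^*$-tight, i.e. for all $i,j\in S$ the map $k\mapsto B^*_{ik}+B^*_{kj}$ is tight. *)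

(* Defs.v *)
From mathcomp Require Import all_boot all_order all_algebra.
From mathcomp Require Import boolp classical_sets cardinality.
From mathcomp Require Import reals ereal.

Set Implicit Arguments.
Unset Strict Implicit.
Unset Printing Implicit Defensive.

Local Open Scope classical_set_scope.
Local Open Scope ring_scope.
Local Open Scope ereal_scope.

(** * Max-plus matrices

    [adde] on [\bar R] satisfies [-oo + +oo = -oo], and [ereal_sup set0 = -oo],
    so the library operations follow the max-plus conventions. *)

Section MaxPlus.
Context {R : realType} {S : Type}.

Definition mp_matrix := S -> S -> \bar R.

Definition mp_id : mp_matrix := fun i j => if `[< i = j >] then 0 else -oo.

Definition mp_mul (B C : mp_matrix) : mp_matrix :=
  fun i j => ereal_sup [set B i k + C k j | k in [set: S]].

Definition mp_pow (B : mp_matrix) (n : nat) : mp_matrix :=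
  iter n (mp_mul B) mp_id.

Definition mp_plus (B : mp_matrix) : mp_matrix :=
  fun i j => ereal_sup [set mp_pow B n i j | n in [set n | (1 <= n)%N]].

Definition mp_star (B : mp_matrix) : mp_matrix :=
  fun i j => ereal_sup [set mp_pow B n i j | n in [set: nat]].

Definition rho (A : mp_matrix) : \bar R :=
  ereal_sup [set ereal_sup [set (k%:R^-1)%:E * mp_pow A k i i | i in [set: S]]
            | k in [set k | (1 <= k)%N]].

(* Only meaningful when [rho A] is finite. *)
Definition normalized (A : mp_matrix) : mp_matrix := fun i j => A i j - rho A.

Definition tight (v : S -> \bar R) : Prop :=
  (forall j, v j != +oo) /\
  (forall beta : R, finite_set [set j | beta%:E <= v j]).

Definition mx_tight (B : mp_matrix) (u : S -> \bar R) : Prop :=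
  forall i, tight (fun j => B i j + u j).

Definition property_T (B : mp_matrix) : Prop :=
  forall j, mx_tight (mp_star B) (fun k => mp_star B k j).

End MaxPlus.
Arguments mp_matrix : clear implicits.

(** * Directed graphs *)

Record digraph (S : Type) := Digraph { nodes : set S; arcs : set (S * S) }.

Section Digraph.
Context {S : Type}.

(* The path (i_0, i_1, ..., i_n) is encoded as [(i_0, [:: i_1; ...; i_n])];
   its length is [size p.2]. *)
Definition is_path (G : digraph S) (p : S * seq S) : Prop :=
  nodes G p.1 /\ path [rel i j | (i, j) \in arcs G] p.1 p.2.

Definition is_circuit (G : digraph S) (c : S * seq S) : Prop :=
  [/\ is_path G c, (1 <= size c.2)%N & last c.1 c.2 = c.1].

Definition path_vertex (p : S * seq S) (t : nat) : S := nth p.1 (p.1 :: p.2) t.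

Definition path_nodes (p : S * seq S) : set S :=
  [set path_vertex p t | t in [set t | (t <= size p.2)%N]].

Definition path_arcs (p : S * seq S) : set (S * S) :=
  [set (path_vertex p t, path_vertex p t.+1) | t in [set t | (t < size p.2)%N]].

Definition reachable (G : digraph S) (i j : S) : Prop :=
  exists p : seq S, is_path G (i, p) /\ last i p = j.

Definition classes (D : set S) (r : S -> S -> Prop) : set (set S) :=
  [set [set j | D j /\ r i j] | i in D].

Definition scc (G : digraph S) : set (set S) :=
  classes (nodes G) (fun i j => reachable G i j /\ reachable G j i).

End Digraph.

(** * Critical and recurrent nodes *)

Section Critical.
Context {R : realType} {S : Type}.
Implicit Type A : mp_matrix R S.

Definition graph A : digraph S :=
  Digraph [set: S] [set a | A a.1 a.2 != -oo].

Definition weight A (p : S * seq S) : \bar R :=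
  \sum_(t < size p.2) A (path_vertex p t) (path_vertex p t.+1).

Definition critical_circuit A (c : S * seq S) : Prop :=
  is_circuit (graph A) c /\ ((size c.2)%:R^-1)%:E * weight A c = rho A.

Definition critical_graph A : digraph S :=
  Digraph (\bigcup_(c in critical_circuit A) path_nodes c)
          (\bigcup_(c in critical_circuit A) path_arcs c).

Definition critical_nodes A : set S := nodes (critical_graph A).

Definition critical_classes A : set (set S) := scc (critical_graph A).

Definition recurrent_nodes A : set S :=
  [set i | mp_plus (normalized A) i i = 0].

Definition recurrence_rel A (i j : S) : Prop :=
  mp_plus (normalized A) i j + mp_plus (normalized A) j i = 0.

Definition recurrence_classes A : set (set S) :=
  classes (recurrent_nodes A) (recurrence_rel A).

(* The endpoints of such an arc are automatically recurrent when [rho A] is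
   finite: no diagonal entry of [mp_plus (normalized A)] is then positive. *)
Definition recurrence_graph A : digraph S :=
  Digraph (recurrent_nodes A)
          [set a | normalized A a.1 a.2 + mp_plus (normalized A) a.2 a.1 = 0].

End Critical.

(* Main.v *)
(* After normalization every circuit has weight at most 0, and the critical
   circuits are exactly those of weight 0.  Property (T) makes each entry of
   [mp_plus (normalized A)] different from [-oo] the weight of an actual walk.
   So a recurrent node, an arc (i, j) with [~A i j + ~A^+ j i = 0], or a pair of
   nodes with [~A^+ i j + ~A^+ j i = 0] lies on a circuit of weight exactly 0,
   which is critical.  Conversely, rotating a critical circuit so that it starts
   at a given node or arc gives the corresponding equality. *)
Require Import Defs.
From mathcomp Require Import all_boot all_order all_algebra.
From mathcomp Require Import boolp classical_sets cardinality.
From mathcomp Require Import reals ereal.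
From mathcomp Require Import lra.

Import Order.TTheory GRing.Theory Num.Theory.

Local Open Scope classical_set_scope.
Local Open Scope ring_scope.
Local Open Scope ereal_scope.

(** * Weights of walks and max-plus powers *)

Section Weight.
Context {R : realType} {S : Type}.
Implicit Types (A : mp_matrix R S) (x y : S) (p q : seq S).

Lemma weight_nil A x : weight A (x, [::]) = 0.
Proof. by rewrite /weight big_ord0. Qed.

Lemma weight_cons A x y p : weight A (x, y :: p) = A x y + weight A (y, p).
Proof.
rewrite /weight big_ord_recl /path_vertex /=; congr (_ + _).
apply: eq_bigr => t _.
congr (A _ _); apply: set_nth_default; last exact: ltn_ord.
exact: leqW (ltn_ord t).
Qed.

Lemma weight_cat A x p q :
  weight A (x, p ++ q) = weight A (x, p) + weight A (last x p, q).
Proof.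
elim: p x => [|y p IHp] x /=; first by rewrite weight_nil add0e.
by rewrite !weight_cons IHp addeA.
Qed.

Lemma path_vertex_last x p t :
  (t <= size p)%N -> path_vertex (x, p) t = last x (take t p).
Proof.
rewrite /path_vertex => /=; elim: p x t => [|y p IHp] x [|t] //=.
rewrite ltnS => tp; rewrite -IHp//.
case: t tp => [|t] //= tp; exact: set_nth_default.
Qed.

Lemma weight_le_pow A x p :
  weight A (x, p) <= mp_pow A (size p) x (last x p).
Proof.
elim: p x => [|y p IHp] x.
  by rewrite weight_nil /= /mp_id asboolT.
rewrite weight_cons /=.
apply: (@le_trans _ _ (A x y + mp_pow A (size p) y (last y p))).
  exact: leeD2l.
by apply: ereal_sup_ubound; exists y.
Qed.

Lemma weight_le_star A x p : weight A (x, p) <= mp_star A x (last x p).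
Proof.
apply: le_trans (weight_le_pow A x p) _.
by apply: ereal_sup_ubound; exists (size p).
Qed.

Lemma weight_le_plus A x p :
  (0 < size p)%N -> weight A (x, p) <= mp_plus A x (last x p).
Proof.
move=> p0; apply: le_trans (weight_le_pow A x p) _.
by apply: ereal_sup_ubound; exists (size p).
Qed.

Lemma plus_le_star A x y : mp_plus A x y <= mp_star A x y.
Proof.
apply: ge_ereal_sup => _ [n _ <-].
by apply: ereal_sup_ubound; exists n.
Qed.

(** With [weight_le_pow], this makes a power entry the supremum of the weights of the walks of that
    length. The induction keeps [M] general, since peeling off a finite first arc replaces [M] by
    [M - A x k]. *)
Lemma pow_le_of_weight A n x y M : (forall i j, A i j != +oo) ->
  (forall p, size p = n -> last x p = y -> weight A (x, p) <= M) ->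
  mp_pow A n x y <= M.
Proof.
move=> A_lty; elim: n x M => [|n IHn] x M leM.
  rewrite /= /mp_id; case: asboolP => [xy|_]; last exact: leNye.
  by rewrite -(weight_nil A x); apply: leM.
apply: ge_ereal_sup => _ [k _ <-].
have := A_lty x k; case Axk: (A x k) => [r| |] // _; last exact: leNye.
rewrite addeC -leeBrDr//; apply: IHn => p szp lastp.
rewrite leeBrDr// addeC -Axk -weight_cons; apply: leM => //=.
by rewrite szp.
Qed.

Lemma plus_le_of_weight A x y M : (forall i j, A i j != +oo) ->
  (forall p, (0 < size p)%N -> last x p = y -> weight A (x, p) <= M) ->
  mp_plus A x y <= M.
Proof.
move=> A_lty leM; apply: ge_ereal_sup => _ [n n0 <-].
by apply: pow_le_of_weight => // p szp; apply: leM; rewrite szp.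
Qed.

Lemma weight_path_graph A x p : weight A (x, p) != -oo ->
  path [rel i j | (i, j) \in arcs (graph A)] x p.
Proof.
elim: p x => [|y p IHp] x //; rewrite weight_cons adde_eq_ninfty negb_or.
by case/andP => Axy /IHp pyp /=; rewrite pyp andbT inE.
Qed.

(** No arc condition is imposed: a single entry -oo would make the weight -oo, so weight 0 already
    forces a path of the graph. *)
Definition zero_circuit A x p :=
  [/\ (0 < size p)%N, last x p = x & weight A (x, p) = 0].

(** Rotation only exchanges the two summands of the weight. *)
Lemma zero_circuit_rot A x p q : zero_circuit A x (p ++ q) ->
  zero_circuit A (last x p) (q ++ p).
Proof.
rewrite /zero_circuit !size_cat addnC !last_cat => -[-> lx w0].
by split=> //; [rewrite lx|rewrite weight_cat lx addeC -weight_cat].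
Qed.

End Weight.

(** * Maximization over finitely many walks *)

Lemma seq_max {d} {T : orderType d} {U : eqType} (f : U -> T) (s : seq U) x0 :
  x0 \in s -> exists2 x, x \in s & forall y, y \in s -> (f y <= f x)%O.
Proof.
move=> x0s; pose F (i : 'I_(size s)) := f (tnth (in_tuple s) i).
have i0P : (index x0 s < size s)%N by rewrite index_mem.
case: (arg_maxP F (i0 := Ordinal i0P) (P := xpredT)) => // i _ imax.
exists (tnth (in_tuple s) i); first exact: mem_tnth.
by move=> y /(tnthP (in_tuple s))[j ->]; exact: imax.
Qed.

Lemma bounded_seqs {U : eqType} (s : seq U) (n : nat) :
  exists L : seq (seq U),
    forall p, (size p <= n)%N -> {subset p <= s} -> p \in L.
Proof.
elim: n => [|n [L LP]].
  by exists [:: [::]] => -[|y p].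
exists ([::] :: [seq x :: q | x <- s, q <- L]) => -[|y p] //= szp sub.
rewrite inE /=; apply/allpairsP; exists (y, p); split => //=.
  by apply: sub; rewrite mem_head.
by apply: LP => // z zp; apply: sub; rewrite inE zp orbT.
Qed.

(** * Matrices without circuits of positive weight *)

Section NonpositiveCircuits.
Context {R : realType} {S : choiceType} (B : mp_matrix R S).
Hypothesis B_lty : forall i j, B i j != +oo.
Hypothesis circuit_le0 : forall x p, last x p = x -> weight B (x, p) <= 0.

(** Working from the far end, each repeated node closes a circuit, and deleting it cannot lower the
    weight. [uniq] leaves out the start [x], so that a nonempty closed walk stays nonempty. *)
Lemma shorten_walk x p : exists p',
  [/\ uniq p', last x p' = last x p, (0 < size p')%N = (0 < size p)%N &
      weight B (x, p) <= weight B (x, p')].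
Proof.
elim: p x => [|y p IHp] x; first by exists [::].
have [q [uq lq _ wq]] := IHp y.
have [yq|yq] := boolP (y \in q); last first.
  by exists (y :: q); split=> //=; rewrite ?yq// !weight_cons leeD2l.
case/splitPr: yq uq lq wq => a b uq lq wq.
exists (y :: b); split=> //.
- by move: uq; rewrite cat_uniq => /and3P[].
- by rewrite /= -lq last_cat.
rewrite !weight_cons leeD2l//; apply: le_trans wq _.
rewrite -cat_rcons weight_cat last_rcons -[leRHS]add0e leeD2r//.
by rewrite circuit_le0// last_rcons.
Qed.

Hypothesis B_T : property_T B.

(** Tightness at the node [y] itself keeps [mp_star B x y + mp_star B y y] away from +oo, and the
    second term is at least 0 by the empty walk. *)
Lemma star_lty x y : mp_star B x y != +oo.
Proof.
have [+ _] := B_T y x => /(_ y).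
have yy : 0 <= mp_star B y y by rewrite -(weight_nil B y) weight_le_star.
apply: contra => /eqP ->; rewrite addye//.
by apply/eqP => yyN; rewrite yyN in yy.
Qed.

Lemma plus_lty x y : mp_plus B x y != +oo.
Proof.
apply: contra (star_lty x y) => /eqP xyy.
by rewrite -leye_eq -xyy plus_le_star.
Qed.

(* Tightness confines the nearly optimal walks to a finite set of nodes, and
   deleting circuits bounds their length, so only finitely many compete. *)
Lemma plus_attained x y : mp_plus B x y != -oo ->
  exists p, [/\ (0 < size p)%N, last x p = y &
                weight B (x, p) = mp_plus B x y].
Proof.
have := plus_lty x y; case wE: (mp_plus B x y) => [w| |]// _ _.
(* Any positive slack would do in place of 1. The list [s] holds the nodes [k] with
   [mp_star B x k + mp_star B k y] at least [w - 1]. *)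
have [_ /(_ (w - 1)%R)/finite_seqP[s sE]] := B_T y x.
have [L LP] := bounded_seqs s (size s).
pose good p := [&& (0 < size p)%N, last x p == y &
                   (w - 1)%:E <= weight B (x, p)].
have short p : good p -> exists2 q, q \in [seq q <- L | good q] &
    weight B (x, p) <= weight B (x, q).
  case/and3P => p0 /eqP lp wp; have [q [uq lq sq wq]] := shorten_walk x p.
  have wq1 := le_trans wp wq.
  have qs : {subset q <= s}.
    (* Cutting [q] at [k] bounds its weight by [mp_star B x k + mp_star B k y]. *)
    move=> k kq; suff : [set` s] k by [].
    rewrite -sE /=; apply: (le_trans wq1).
    rewrite lp in lq; case/splitPr: kq lq => a b.
    rewrite last_cat /= -cat_rcons weight_cat last_rcons => <-.
    apply: leeD; last exact: weight_le_star.
    by rewrite -[in leRHS](last_rcons x a k) weight_le_star.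
  exists q => //; rewrite mem_filter /good sq p0 lq lp eqxx wq1 /=.
  by apply: LP => //; exact: uniq_leq_size.
have [p0 gp0] : exists p, good p.
  apply: contrapT => /forallNP ngood.
  suff : mp_plus B x y <= (w - 1)%:E.
    rewrite wE lee_fin; lra.
  apply: plus_le_of_weight => // p p0 lp; rewrite leNgt; apply/negP => /ltW wp.
  by apply: (ngood p); rewrite /good p0 lp eqxx.
have [q0 q0L _] := short p0 gp0.
have [q + qmax] := seq_max (fun p => weight B (x, p)) _ q0 q0L.
rewrite mem_filter => /andP[/and3P[sq /eqP lq wq] _].
exists q; split=> //; apply/eqP; rewrite eq_le -wE -{1}lq weight_le_plus//=.
apply: plus_le_of_weight => // p sp lp.
(* A walk below the threshold cannot beat [q], which is above it; a good walk is compared with [q]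
   through its shortening in [L]. *)
have [wp|/ltW wp] := leP (w - 1)%:E (weight B (x, p)); last exact: le_trans wq.
have [|r rL wr] := short p; first by rewrite /good sp lp eqxx.
exact: le_trans (qmax r rL).
Qed.

Lemma plus_diag_le0 x : mp_plus B x x <= 0.
Proof. by apply: plus_le_of_weight => // p _; exact: circuit_le0. Qed.

(** Optimal walks from [plus_attained] are concatenated; a term -oo on the left makes the bound
    trivial. *)
Lemma plus_triangle x y z :
  mp_plus B x y + mp_plus B y z <= mp_plus B x z.
Proof.
have [->|/plus_attained[p [p0 lp <-]]] := eqVneq (mp_plus B x y) -oo.
  by rewrite addNye leNye.
have [->|/plus_attained[q [q0 lq <-]]] := eqVneq (mp_plus B y z) -oo.
  by rewrite addeNy leNye.
rewrite -lq -{1}lp -weight_cat -lp -last_cat weight_le_plus//.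
by rewrite size_cat addn_gt0 p0.
Qed.

Lemma plus_sym_le0 x y : mp_plus B x y + mp_plus B y x <= 0.
Proof. exact: le_trans (plus_triangle x y x) (plus_diag_le0 x). Qed.

Lemma le_plus x y : B x y <= mp_plus B x y.
Proof.
by have := weight_le_plus B x [:: y] isT; rewrite weight_cons weight_nil adde0.
Qed.

Lemma zero_circuit_node x : (exists p, zero_circuit B x p) <-> mp_plus B x x = 0.
Proof.
split=> [[p [p0 lp wp]]|xx0].
  apply/eqP; rewrite eq_le plus_diag_le0 /= -wp -{3}lp.
  exact: weight_le_plus.
have [|p [p0 lp wp]] := plus_attained x x; first by rewrite xx0.
by exists p; split=> //; rewrite wp.
Qed.

Lemma zero_circuit_arc x y :
  (exists p, zero_circuit B x (y :: p)) <-> B x y + mp_plus B y x = 0.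
Proof.
split=> [[p [_ /= lp wp]]|xy0].
  apply/eqP; rewrite eq_le (le_trans (leeD2r _ (le_plus x y)) (plus_sym_le0 x y)).
  (* [p] is empty for a loop, so go once more around the circuit. *)
  rewrite /= -{1}wp weight_cons leeD2l// -[leLHS]adde0 -wp -{1}lp -weight_cat.
  have := weight_le_plus B y (p ++ y :: p).
  by rewrite last_cat /= lp size_cat addnS; apply.
have [|p [p0 lp wp]] := plus_attained y x.
  by apply: contra_eqN xy0 => /eqP ->; rewrite addeNy.
by exists p; split=> //; rewrite weight_cons wp.
Qed.

End NonpositiveCircuits.

(** * Normalization by the maximal circuit mean *)

Section Normalization.
Context {R : realType} {S : Type} (A : mp_matrix R S).
Hypothesis rho_fin : rho A \is a fin_num.

Lemma weight_normalized x p :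
  weight (normalized A) (x, p) = weight A (x, p) - (size p)%:R%:E * rho A.
Proof.
rewrite -(fineK rho_fin) -EFinM.
elim: p x => [|y p IHp] x; first by rewrite !weight_nil mul0r sube0.
rewrite !weight_cons IHp /normalized -(fineK rho_fin) /=.
rewrite addeACA; congr (_ + _); congr EFin.
by rewrite mulrSr mulrDl mul1r opprD addrC.
Qed.

Lemma normalized_circuit_le0 x p :
  last x p = x -> weight (normalized A) (x, p) <= 0.
Proof.
have [/size0nil ->|p0] := posnP (size p); first by rewrite weight_nil.
move=> lp; rewrite weight_normalized leeBlDr; last by rewrite fin_numM.
rewrite add0e.
rewrite -lee_pdivrMl ?ltr0n//.
apply: (@le_trans _ _ (((size p)%:R^-1)%:E * mp_pow A (size p) x x)).
  by rewrite lee_pmul2l// ?lte_fin ?invr_gt0 ?ltr0n// -{3}lp weight_le_pow.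
apply: (@le_trans _ _
  (ereal_sup [set (((size p)%:R^-1)%:E * mp_pow A (size p) i i) | i in [set: S]])).
  by apply: ereal_sup_ubound; exists x.
by apply: ereal_sup_ubound; exists (size p).
Qed.

Lemma critical_circuitP x p :
  critical_circuit A (x, p) <-> zero_circuit (normalized A) x p.
Proof.
(* For infinite [w] both sides fail, since [rho A] is finite; for real [w] this is division by
   [n]. *)
have mean (n : nat) w : (0 < n)%N ->
    (n%:R^-1)%:E * w = rho A <-> w - n%:R%:E * rho A = 0.
  move=> n0; rewrite -(fineK rho_fin); set r := fine _.
  have n0R : (n%:R : R) != 0%R by rewrite pnatr_eq0 -lt0n.
  have ng0 : (0 < n%:R^-1 :> R)%R by rewrite invr_gt0 ltr0n.
  case: w => [w| |]; last 2 first.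
  - by rewrite gt0_muley ?lte_fin.
  - by rewrite gt0_muleNy ?lte_fin.
  split=> [[wr]|/eqP]; first by rewrite -wr -EFinM mulrA divff// mul1r -EFinB subrr.
  by rewrite -EFinM -EFinB eqe subr_eq0 => /eqP ->; rewrite -EFinM mulrA mulVf// mul1r.
split=> [[[_ /= p0 lp] /mean]|[p0 lp w0]].
  by rewrite -weight_normalized => w0; split=> //; exact: w0.
split; last by apply/mean => //; rewrite -weight_normalized.
split=> //; split=> //; apply: weight_path_graph => /=.
by apply: contra_eqN w0 => /eqP wN; rewrite weight_normalized wN addNye.
Qed.

End Normalization.

(** * Critical graph and recurrence graph *)

Section CriticalGraph.
Context {R : realType} {S : choiceType} (A : mp_matrix R S).
Hypothesis A_lty : forall i j : S, A i j != +oo.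
Hypothesis rho_fin : rho A \is a fin_num.
Hypothesis A_T : property_T (normalized A).
Let B := normalized A.

Let B_lty i j : B i j != +oo.
Proof.
rewrite /B /normalized -(fineK rho_fin).
by case: (A i j) (A_lty i j).
Qed.

Let circuit_le0 := normalized_circuit_le0 A rho_fin.

Lemma critical_node_plus x : critical_nodes A x <-> mp_plus B x x = 0.
Proof.
rewrite -zero_circuit_node//; split=> [[[y p] /critical_circuitP-/(_ rho_fin)yp]|].
  case=> t /= tp <-; rewrite path_vertex_last//.
  by exists (drop t p ++ take t p); apply: zero_circuit_rot; rewrite cat_take_drop.
case=> p xp; exists (x, p); first exact/critical_circuitP.
by exists 0%N.
Qed.

Lemma critical_arc_plus x y :
  arcs (critical_graph A) (x, y) <-> B x y + mp_plus B y x = 0.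
Proof.
rewrite -zero_circuit_arc//; split=> [[[z p] /critical_circuitP-/(_ rho_fin)zp]|].
  case=> t /= tp [<- <-]; rewrite path_vertex_last ?(ltnW tp)//.
  (* Rotation by [t] starts the circuit at the tail of the arc, which thus becomes its first
     step. *)
  exists (drop t.+1 p ++ take t p); rewrite /path_vertex /= -cat_cons -drop_nth//.
  by apply: zero_circuit_rot; rewrite cat_take_drop.
case=> p xp; exists (x, y :: p); first exact/critical_circuitP.
by exists 0%N.
Qed.

Lemma critical_graphE : critical_graph A = recurrence_graph A.
Proof.
have nodesE : nodes (critical_graph A) = nodes (recurrence_graph A).
  by apply/seteqP; split=> x /critical_node_plus.
have arcsE : arcs (critical_graph A) = arcs (recurrence_graph A).
  by apply/seteqP; split=> -[x y] /critical_arc_plus.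
move: nodesE arcsE; case: (critical_graph A) => n a /= -> ->.
by [].
Qed.

Lemma zero_circuit_arcs x p :
  zero_circuit B x p -> path [rel i j | (i, j) \in arcs (critical_graph A)] x p.
Proof.
move=> xp; apply/(pathP x) => t tp; rewrite /= inE.
exists (x, p); first exact/critical_circuitP.
by exists t.
Qed.

(** Induction along the path: each critical arc relates its endpoints, its head is again recurrent,
    and two applications of [plus_triangle] give transitivity. *)
Lemma reachable_recurrence_rel x y : mp_plus B x x = 0 ->
  reachable (critical_graph A) x y -> recurrence_rel A x y.
Proof.
move=> xx0 [p [[_ /= +] <-]]; rewrite /recurrence_rel -/B.
elim: p x xx0 => [|z p IHp] x xx0 /=; first by rewrite xx0 add0e.
case/andP => /set_mem/critical_arc_plus xz0 zp.
have xz : 0 <= mp_plus B x z + mp_plus B z x.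
  by rewrite -xz0 leeD2r// le_plus.
have zz : mp_plus B z z = 0.
  apply/eqP; rewrite eq_le plus_diag_le0//=; apply: (le_trans xz).
  by rewrite addeC plus_triangle.
apply/eqP; rewrite eq_le plus_sym_le0//= -[leLHS]adde0 -[X in _ + X](IHp z zz zp).
(* The four terms are regrouped into [x] to [z] to [y] and [y] to [z] to [x]. *)
apply: le_trans (leeD2r _ xz) _; rewrite addeACA [X in _ + X <= _]addeC.
by apply: leeD; rewrite plus_triangle.
Qed.

Lemma recurrence_rel_zero_circuit x y : recurrence_rel A x y ->
  exists p q, last x p = y /\ zero_circuit B x (p ++ q).
Proof.
rewrite /recurrence_rel -/B => xy0.
have [|p [p0 lp wp]] := plus_attained B B_lty circuit_le0 A_T x y.
  by apply: contra_eqN xy0 => /eqP ->; rewrite addNye.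
have [|q [q0 lq wq]] := plus_attained B B_lty circuit_le0 A_T y x.
  by apply: contra_eqN xy0 => /eqP ->; rewrite addeNy.
exists p, q; split=> //; split.
- by rewrite size_cat addn_gt0 p0.
- by rewrite last_cat lp.
- by rewrite weight_cat lp wp wq.
Qed.

(** The walk to [y] is a prefix of a circuit of weight 0, all of whose arcs are critical. *)
Lemma recurrence_rel_reachable x y :
  recurrence_rel A x y -> reachable (critical_graph A) x y.
Proof.
move=> /recurrence_rel_zero_circuit[p [q [lp xpq]]]; exists p; split=> //; split.
  by apply/critical_node_plus/zero_circuit_node => //; exists (p ++ q).
by have := zero_circuit_arcs _ _ xpq; rewrite cat_path => /andP[].
Qed.

Lemma critical_classesE : critical_classes A = recurrence_classes A.
Proof.
rewrite /critical_classes /scc critical_graphE /=.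
apply: eq_imagel => x xr; apply/seteqP; split=> y /=; rewrite -critical_graphE.
  (* One direction of reachability suffices, as [x] is recurrent. *)
  by move=> [yr [xy _]]; split=> //; exact: reachable_recurrence_rel xy.
move=> [yr xy]; split=> //; split; apply: recurrence_rel_reachable => //.
by rewrite /recurrence_rel addeC.
Qed.

End CriticalGraph.

Theorem theorem4p9 (R : realType) (S : Type) (A : mp_matrix R S)
    (S_infinite : infinite_set [set: S])
    (A_lty : forall i j : S, A i j != +oo)
    (rho_fin : rho A \is a fin_num)
    (A_T : property_T (normalized A)) :
  [/\ critical_nodes A = recurrent_nodes A,
      critical_classes A = recurrence_classes A
    & critical_graph A = recurrence_graph A].
Proof.
have graphE : critical_graph A = recurrence_graph A.
  (* [{classic S}] equips the bare type [S] with the choice structure assumed above. *)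
  exact: (@critical_graphE R {classic S} A).
split=> //; first by rewrite /critical_nodes graphE.
exact: (@critical_classesE R {classic S} A).
Qed.
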